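(* Let $\mathcal{H}$ be a complex separable infinite-dimensional Hilbert space and let $T$ be a bounded linear operator on $\mathcal{H}$. Assume that $T$ has a frame of iterations. Then $T^*$ has a frame of iterations if and only if $T$ is strongly stable.
   Context: A countable family $\{x_k\}_k$ in $\mathcal{H}$ is a frame of $\mathcal{H}$ if there are $A,B>0$ with $A\|x\|^2\leqslant\sum_k|\langle x,x_k\rangle|^2\leqslant B\|x\|^2$ for all $x\in\mathcal{H}$. A bounded operator $T$ on $\mathcal{H}$ has a frame of iterations if there is an at most countable collection $\{v_i\}_{i\in I}\subseteq\mathcal{H}$ such that $\{T^nv_i\}_{i\in I,n\geqslant0}$ is a frame of $\mathcal{H}$. $T$ is strongly stable if $T^nv\to0$ as $n\to+\infty$ for all $v\in\mathcal{H}$. *)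

(* Defs.v *)
From HB Require Import structures.
From mathcomp Require Import all_boot all_order all_algebra.
From mathcomp Require Import sesquilinear complex.
From mathcomp Require Import all_classical all_reals all_analysis.

Set Implicit Arguments.
Unset Strict Implicit.
Unset Printing Implicit Defensive.

Import Order.TTheory GRing.Theory Num.Theory.
Import numFieldNormedType.Exports.

Local Open Scope classical_set_scope.
Local Open Scope complex_scope.
Local Open Scope ring_scope.

Section Defs.
Context {R : realType} {H : normedModType R[i]}.
Implicit Types (dot : H -> H -> R[i]) (T : H -> H).

Definition separable := exists2 D : set H, countable D & dense D.

Definition finite_dimensional := exists s : seq H, forall x : H,
  exists c : 'I_(size s) -> R[i], x = \sum_(i < size s) c i *: s`_i.

Definition bounded_operator T :=
  exists M : R, forall x : H, `|T x| <= M%:C * `|x|.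

(* Norms over R[i] take their (real, nonnegative) values in R[i]; complex.Re
   brings the squares back to R.  The sum is an unordered sum in [0, +oo], and
   a countType may be finite or empty. *)
Definition is_frame dot (K : countType) (f : K -> H) :=
  exists A B : R, [/\ 0 < A, 0 < B & forall x : H,
    let S := \esum_(k in [set: K]) (complex.Re (`|dot x (f k)| ^+ 2))%:E in
    ((A * complex.Re (`|x| ^+ 2))%:E <= S <=
     (B * complex.Re (`|x| ^+ 2))%:E)%E].

Definition has_frame_of_iterations dot T :=
  exists (I : countType) (v : I -> H),
    is_frame dot (fun k : I * nat => iter k.2 T (v k.1)).

Definition strongly_stable T :=
  forall v : H, iter n T v @[n --> \oo] --> (0 : H).

(* The value at y is the vector representing x |-> dot (T x) y: it is unique,
   and by the Riesz representation theorem it exists when T is a bounded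
   operator on a Hilbert space; the default 0 is then never used. *)
Definition adjoint dot T (y : H) : H :=
  xget 0 [set z | forall x, dot (T x) y = dot x z].

End Defs.

Arguments separable {R} H.
Arguments finite_dimensional {R} H.

Lemma adjoint_eq (R : realType) (H : normedModType R[i])
    (dot : {dot H for Num.conj}) (T S : H -> H) :
  (forall x y, dot (T x) y = dot x (S y)) -> adjoint dot T = S.
Proof.
move=> TS; apply/funext => y; apply: xget_unique => [x|z zP]; first exact: TS.
apply/eqP; rewrite -subr_eq0 -(dnorm_eq0 dot) linearBr.
by rewrite subr_eq0; apply/eqP; exact: etrans (esym (zP _)) (TS _ _).
Qed.

(* Main.v *)
Require Import Defs.
From HB Require Import structures.
From mathcomp Require Import all_boot all_order all_algebra.
From mathcomp Require Import sesquilinear complex ring lra.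
From mathcomp Require Import all_classical all_reals all_analysis.

Import Order.TTheory GRing.Theory Num.Theory.
Import numFieldNormedType.Exports.

Local Open Scope classical_set_scope.
Local Open Scope complex_scope.
Local Open Scope ring_scope.

(** Write S for the adjoint of T.  Since <x, T^n v> = <S^n x, v>, the frame
sum of the family (T^n v_i) at x is G(x) = sum_n p(S^n x), where
p(x) = sum_i |<x, v_i>|^2; it is a quadratic form comparable to |x|^2, and
G(x) = p(x) + G(S x).

Hence G(S^n x) is a tail of a convergent series, so that S^n x tends to 0: if
an operator has a frame of iterations, its adjoint is strongly stable
([adjoint_frame_stable]).  Applied to S, this is the direct implication.

For the converse, G(S x) <= G(x) says that S is a contraction for the norm
defined by G.  Dually T is a contraction for the norm defined by the inverse
form h(x) = <x, P x>, where P is the inverse of the frame operator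
([inverse_form]).  So the defect d(x) = h(x) - h(T x) is a nonnegative
quadratic form, and when T is strongly stable the sum of the d(T^n x)
telescopes to h(x), which is again comparable to |x|^2.  It remains to write
d(x) as sum_j |<x, w_j>|^2: then (S^n w_j) is a frame ([defect_frame]).  The
vectors w_j are obtained by a Cholesky factorization of d along a dense
sequence ([esum_sqr_rdot_pivots]): subtracting one rank-one square after the
other, each chosen so that the rest vanishes on one more term of the sequence.
No square root of an operator is involved.

Everything is done with symmetric forms that are bilinear over the reals, with
Re <x, y> in the place of the inner product, because
|<x, w>|^2 = (Re <x, w>)^2 + (Re <i x, w>)^2 turns real sums of squares at x
and i x into complex ones.  Both the adjoint and the operator P come from
the Riesz representation theorem for a bounded coercive form
([symform_riesz]). *)

(** * Real symmetric bilinear forms on a complex vector space *)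

Lemma discriminant_le (R : realFieldType) (a b c : R) : 0 <= c ->
  (forall t, 0 <= a + 2 * t * b + t ^+ 2 * c) -> b ^+ 2 <= a * c.
Proof.
rewrite le_eqVlt => /orP[/eqP<-|c0] P.
  have [->|b0] := eqVneq b 0; first by rewrite expr0n mulr0.
  have := P (- (a + 1) / (2 * b)).
  have -> : a + 2 * (- (a + 1) / (2 * b)) * b
            + (- (a + 1) / (2 * b)) ^+ 2 * 0 = -1 by field.
  by rewrite lerNr oppr0 ler10.
have := P (- b / c).
have -> : a + 2 * (- b / c) * b + (- b / c) ^+ 2 * c = (a * c - b ^+ 2) / c.
  by field; rewrite gt_eqF.
by rewrite pmulr_lge0 ?invr_gt0// subr_ge0.
Qed.

Section SymForm.
Context {R : realType} {V : lmodType R[i]}.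
Implicit Types (F : V -> V -> R) (x y z : V) (a t : R).

Definition symform F :=
  [/\ forall x y, F x y = F y x,
      forall x y z, F (x + y) z = F x z + F y z
    & forall a x y, F (a%:C *: x) y = a * F x y].

Definition nonneg_symform F := symform F /\ forall x, 0 <= F x x.

Context {F} (sF : symform F).

Lemma symformC x y : F x y = F y x. Proof. by case: sF. Qed.

Lemma symformDl x y z : F (x + y) z = F x z + F y z. Proof. by case: sF. Qed.

Lemma symformDr x y z : F x (y + z) = F x y + F x z.
Proof. by rewrite !(symformC x) symformDl. Qed.

Lemma symformZl a x y : F (a%:C *: x) y = a * F x y. Proof. by case: sF. Qed.

Lemma symformZr a x y : F x (a%:C *: y) = a * F x y.
Proof. by rewrite !(symformC x) symformZl. Qed.

Lemma symformNl x y : F (- x) y = - F x y.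
Proof.
by rewrite -scaleN1r -[in LHS](rmorphN1 (real_complex R)) symformZl mulN1r.
Qed.

Lemma symformNr x y : F x (- y) = - F x y.
Proof. by rewrite !(symformC x) symformNl. Qed.

Lemma symformBl x y z : F (x - y) z = F x z - F y z.
Proof. by rewrite symformDl symformNl. Qed.

Lemma symformBr x y z : F x (y - z) = F x y - F x z.
Proof. by rewrite symformDr symformNr. Qed.

Lemma symform_expand x y t :
  F (x + t%:C *: y) (x + t%:C *: y) = F x x + 2 * t * F x y + t ^+ 2 * F y y.
Proof.
rewrite !(symformDl, symformDr, symformZl, symformZr) (symformC y x); ring.
Qed.

End SymForm.

Section NonNegSymForm.
Context {R : realType} {V : lmodType R[i]} {F : V -> V -> R}.
Hypothesis nF : nonneg_symform F.

Lemma symform_cauchy_schwarz x y : F x y ^+ 2 <= F x x * F y y.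
Proof.
case: nF => sF F0; apply: discriminant_le => // t.
by rewrite -(symform_expand sF).
Qed.

Lemma symform_null x y : F y y = 0 -> F x y = 0.
Proof.
move=> y0; have := symform_cauchy_schwarz x y.
by rewrite y0 mulr0 => h; apply/eqP; rewrite -sqrf_eq0 eq_le h sqr_ge0.
Qed.

End NonNegSymForm.


(** * Sums of forms *)

Lemma esumZ (R : realType) (K : choiceType) (c : R) (f : K -> \bar R) :
  0 <= c -> (forall k, 0 <= f k)%E ->
  (\esum_(k in [set: K]) (c%:E * f k) = c%:E * \esum_(k in [set: K]) f k)%E.
Proof.
move=> c0 f0; rewrite /esum -ereal_supZl//.
  congr ereal_sup; apply/seteqP; split => [_ [X fX <-]|_ [_ [X fX <-] <-]] /=.
    by exists (\sum_(k \in X) f k)%E; [exists X|rewrite ge0_mule_fsumr].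
  by exists X => //; rewrite ge0_mule_fsumr.
apply/set0P; exists (\sum_(k \in set0) f k)%E, set0 => //; exact: fsets_set0.
Qed.

Section SumForm.
Context {R : realType} {V : lmodType R[i]} {K : choiceType}.
Context {F : K -> V -> V -> R}.
Hypothesis nF : forall k, nonneg_symform (F k).
Let Q x := (\esum_(k in [set: K]) (F k x x)%:E)%E.
Hypothesis Qfin : forall x, (Q x < +oo)%E.

(** The sum q of the quadratic forms is only known as a nonnegative unordered
sum, which allows addition and scaling by nonnegative reals but no
subtraction.  The identities q3 and qZ are therefore arranged with nonnegative
coefficients on both sides; together they say that the polarization of q is
bilinear. *)
Lemma sum_symform : exists G : V -> V -> R, nonneg_symform G /\
  forall x, (G x x)%:E = Q x.
Proof.
pose q x := fine (Q x).
have F0 k x : 0 <= F k x x by case: (nF k).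
have qQ x : (q x)%:E = Q x.
  by rewrite fineK// ge0_fin_numE//; apply: esum_ge0 => k _; rewrite lee_fin.
have q_ge0 x : 0 <= q x.
  by rewrite -lee_fin qQ; apply: esum_ge0 => k _; rewrite lee_fin.
have q3 x y z : q (x + y + z) + q x + q y + q z = q (x + y) + q (y + z) + q (x + z).
  apply/EFin_inj; rewrite !EFinD !qQ -!esumD; last first.
  all: try by move=> k _; rewrite ?adde_ge0 ?lee_fin.
  apply: eq_esum => k _; rewrite -!EFinD; congr (_%:E).
  have [sF _] := nF k; rewrite !(symformDl sF, symformDr sF).
  rewrite (symformC sF y x) (symformC sF z x) (symformC sF z y); ring.
have qZ a x y : 0 <= a ->
    q (a%:C *: x + y) + a * q x + a * q y = a ^+ 2 * q x + q y + a * q (x + y).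
  move=> a0; apply/EFin_inj; rewrite !EFinD !(EFinM a) !(EFinM (a ^+ 2)) !qQ.
  rewrite -!esumZ -?esumD; last first.
  all: try by move=> *; rewrite ?sqr_ge0 ?adde_ge0 ?mule_ge0 ?lee_fin// sqr_ge0.
  all: try by rewrite sqr_ge0.
  apply: eq_esum => k _; rewrite -!EFinM -!EFinD; congr (_%:E).
  have [sF _] := nF k.
  rewrite !(symformDl sF, symformDr sF, symformZl sF, symformZr sF).
  rewrite (symformC sF y x); ring.
pose G x y := (q (x + y) - q x - q y) / 2.
have q0 : q 0 = 0.
  by have := qZ 2 0 0 (ler0n _ _); rewrite scaler0 addr0; lra.
have GC x y : G x y = G y x by rewrite /G [x + y]addrC; lra.
have GD x y z : G (x + y) z = G x z + G y z.
  by have := q3 x y z; rewrite /G; lra.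
have G0 y : G 0 y = 0 by rewrite /G add0r q0; lra.
have GZ a x y : 0 <= a -> G (a%:C *: x) y = a * G x y.
  move=> a0; have := qZ a x y a0; have := qZ a x 0 a0.
  rewrite /G !addr0 q0 => h1 h2; lra.
have Gxx x : G x x = q x.
  have := qZ 2 x 0 (ler0n _ _); rewrite !addr0 q0 /G.
  by rewrite rmorph_nat scaler_nat mulr2n; lra.
exists G; split; last by move=> x; rewrite Gxx qQ.
split; last by move=> x; rewrite Gxx.
(* Negative scalars follow by additivity, as G (a x) + G (- a x) = G 0. *)
split=> // a x y; have [/GZ->//|/ltW a0] := leP 0 a.
apply/eqP; rewrite -subr_eq0 -[a in a * _]opprK mulNr opprK -GZ ?oppr_ge0//.
by rewrite -GD rmorphN/= scaleNr subrr G0.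
Qed.

End SumForm.

(** * The real inner product and its completeness *)

Section RealInner.
Context {R : realType} {H : completeNormedModType R[i]}.
Context (dot : {dot H for Num.conj}).
Hypothesis dot_norm : forall x : H, dot x x = `|x| ^+ 2.
Implicit Types (x y z : H).

Definition rdot x y : R := complex.Re (dot x y).

Lemma dotC x y : dot y x = (dot x y)^*%C.
Proof. by rewrite hermC /= expr0 mul1r. Qed.

(** The imaginary part of an inner product is a real part at i x. *)
Lemma dotiE x y : dot x y = rdot x y +i* - rdot ('i%C *: x) y.
Proof.
rewrite /rdot linearZl_LR/= mulrC.
by case: (dot x y) => u v /=; rewrite mulr0 mulr1 sub0r opprK.
Qed.

Lemma rdot_symform : symform rdot.
Proof.
split=> [x y|x y z|a x y]; rewrite /rdot.
- by rewrite dotC; case: (dot y x).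
- by rewrite linearDl raddfD.
- by rewrite linearZl_LR/=; case: (dot x y) => u v /=; rewrite mul0r subr0.
Qed.

Lemma Re_sqr_dot x y :
  complex.Re (`|dot x y| ^+ 2) = rdot x y ^+ 2 + rdot ('i%C *: x) y ^+ 2.
Proof. by rewrite -add_Re2_Im2 dotiE /= sqrrN. Qed.

Lemma normE x : `|x| = (complex.Re `|x|)%:C.
Proof. by rewrite RRe_real// ger0_real. Qed.

Lemma rdotxx x : rdot x x = complex.Re (`|x| ^+ 2).
Proof. by rewrite /rdot dot_norm. Qed.

Lemma rdot_sqr x : rdot x x = complex.Re `|x| ^+ 2.
Proof. by rewrite rdotxx normE -rmorphXn. Qed.

Lemma rdot_nonneg : nonneg_symform rdot.
Proof. by split; [exact: rdot_symform|move=> x; rewrite rdot_sqr sqr_ge0]. Qed.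

Lemma norm_lt_rdot x (e : R) : 0 < e -> (`|x| < e%:C) = (rdot x x < e ^+ 2).
Proof.
move=> e0; rewrite rdot_sqr normE ltcR [RHS]ltr_pXn2r// nnegrE ?(ltW e0)//.
by rewrite -lecR -normE normr_ge0.
Qed.

Lemma gt0_complex (e : R[i]) : 0 < e -> exists2 d : R, 0 < d & e = d%:C.
Proof.
move=> e0; exists (complex.Re e); last by rewrite RRe_real// gtr0_real.
by move: e0; rewrite ltcE => /andP[_].
Qed.

Lemma cvg_rdotP (u : nat -> H) l : (u n @[n --> \oo] --> l) <->
  forall e : R, 0 < e -> \forall n \near \oo, rdot (l - u n) (l - u n) < e.
Proof.
split=> [/cvgrPdist_lt ul e e0|ul].
  have s0 : 0 < Num.sqrt e by rewrite sqrtr_gt0.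
  have /ul : 0 < (Num.sqrt e)%:C by rewrite ltcR.
  by apply: filterS => n; rewrite norm_lt_rdot// sqr_sqrtr// ltW.
apply/cvgrPdist_lt => _ /gt0_complex[e e0 ->].
by have := ul _ (exprn_gt0 2 e0); apply: filterS => n; rewrite norm_lt_rdot.
Qed.

Lemma rdot_complete (u : nat -> H) :
  (forall e : R, 0 < e -> exists N, forall m n, (N <= m)%N -> (N <= n)%N ->
     rdot (u m - u n) (u m - u n) < e) ->
  exists l : H, u n @[n --> \oo] --> l.
Proof.
move=> cu; apply/cvg_ex; apply/cauchy_cvgP/cauchy_exP => _ /gt0_complex[e e0 ->].
have [N Nu] := cu _ (exprn_gt0 2 e0).
exists (u N); exists N => // n /= Nn.
by rewrite -ball_normE /= norm_lt_rdot// Nu.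
Qed.

Lemma rdot_dense : separable H -> exists s : nat -> H,
  forall x (e : R), 0 < e -> exists n, rdot (x - s n) (x - s n) < e.
Proof.
move=> [D /countable_injP[f finj] Dd].
exists (fun n => xget 0 [set y | D y /\ f y = n]) => x e e0.
have s0 : 0 < Num.sqrt e by rewrite sqrtr_gt0.
have s0C : 0 < (Num.sqrt e)%:C by rewrite ltcR.
have [||y [xy Dy]] := Dd (ball x (Num.sqrt e)%:C).
- by exists x; exact: ballxx.
- exact: ball_open.
exists (f y); rewrite (@xget_unique _ 0 _ y) => [||z [Dz fz]] //.
  by move: xy; rewrite -ball_normE /= norm_lt_rdot// sqr_sqrtr// ltW.
by apply: finj => //; rewrite inE.
Qed.

Lemma bounded_rdot (T : H -> H) : bounded_operator T ->
  exists2 M : R, 0 <= M & forall x, rdot (T x) (T x) <= M * rdot x x.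
Proof.
move=> [M TM]; exists (M ^+ 2) => [|x]; first exact: sqr_ge0.
rewrite !rdot_sqr.
have := TM x; rewrite (normE x) (normE (T x)) -rmorphM lecR => h.
rewrite -exprMn ler_pXn2r// nnegrE.
  by rewrite -lecR -normE normr_ge0.
by apply: le_trans h; rewrite -lecR -normE normr_ge0.
Qed.

(** * The Riesz representation theorem *)

(** A minimizer of J(x) = F(x, x) - 2 l(x) represents l.  A minimizing sequence
is Cauchy by the parallelogram identity, and along it F(u_n, y) - l(y) is
controlled by the excess of J(u_n) over its infimum, through the discriminant
of t |-> J(u_n + t y). *)
Lemma symform_riesz (F : H -> H -> R) (c C M : R) (l : H -> R) :
  symform F -> 0 < c -> (forall x, c * rdot x x <= F x x) ->
  0 < C -> (forall x, F x x <= C * rdot x x) ->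
  {morph l : x y / x + y} -> (forall (a : R) x, l (a%:C *: x) = a * l x) ->
  0 <= M -> (forall x, l x ^+ 2 <= M * rdot x x) ->
  exists z, forall x, F z x = l x.
Proof.
move=> sF c0 cF C0 FC lD lZ M0 lM.
have rdot_ge0 x : 0 <= rdot x x by case: rdot_nonneg => _ ->.
have nF : nonneg_symform F.
  by split=> // x; apply: le_trans (cF x); rewrite mulr_ge0// ltW.
have F_ge0 x : 0 <= F x x by case: nF.
pose J x := F x x - 2 * l x.
pose E := [set J x | x in [set: H]].
(* Completing the square, with l(x)^2 <= M |x|^2. *)
have J_lb x : - (M / c) <= J x.
  have h1 := cF x; have h2 := lM x.
  suff : 2 * l x <= c * rdot x x + M / c by rewrite /J; lra.
  have M1 : (c * rdot x x) * (M / c) = M * rdot x x by field; rewrite gt_eqF.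
  have M2 : 0 <= M / c by rewrite divr_ge0// ltW.
  have c1 : 0 <= c * rdot x x by rewrite mulr_ge0// ltW.
  have [//|] := leP (2 * l x) (c * rdot x x + M / c).
  move: (c * rdot x x) (M / c) (l x) M1 M2 c1 h2 => s t k <- t0 s0 kst stk.
  have := sqr_ge0 (s - t); have : (s + t) ^+ 2 < (2 * k) ^+ 2.
    by rewrite ltr_pXn2r// nnegrE; lra.
  rewrite !expr2 in kst *; nra.
have infE : has_inf E.
  split; first by exists (J 0), 0.
  by exists (- (M / c)) => _ [x _ <-].
pose m := inf E.
have mJ x : m <= J x by apply: ge_inf; [case: infE|exists x].
pose ep n : R := n.+1%:R^-1.
have ep0 n : 0 < ep n by rewrite invr_gt0 ltr0n.
have epP (e : R) : 0 < e -> \forall n \near \oo, ep n < e.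
  by move=> e0; exact: (near_infty_natSinv_lt (PosNum e0)).
have /choice[u uP] : forall n, exists x, J x < m + ep n.
  move=> n; have [_ [x _ <-] xP] := inf_adherent (ep0 n) infE.
  by exists x.
have lin_u n y : (F (u n) y - l y) ^+ 2 <= ep n * F y y.
  apply: discriminant_le => // t.
  have := mJ (u n + t%:C *: y); have := uP n.
  rewrite /J (symform_expand sF) lD lZ; lra.
(* The parallelogram identity for F; the linear terms of J cancel. *)
have midJ x y : F (x - y) (x - y) = 2 * (J x + J y - 2 * J ((2^-1)%:C *: (x + y))).
  rewrite /J lZ lD.
  rewrite !(symformDl sF, symformDr sF, symformZl sF, symformZr sF).
  rewrite !(symformNl sF, symformNr sF) (symformC sF y x).
  by field; rewrite ?pnatr_eq0.
have [z uz] : exists z : H, u n @[n --> \oo] --> z.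
  apply: rdot_complete => e e0.
  have [|N _ Ne] := epP (c * e / 4); first by rewrite divr_gt0 ?mulr_gt0.
  exists N => p q Np Nq.
  have := midJ (u p) (u q); have := uP p; have := uP q.
  have := mJ ((2^-1)%:C *: (u p + u q)); have := cF (u p - u q).
  have := Ne p Np; have := Ne q Nq => /= *.
  rewrite -(ltr_pM2l c0); lra.
exists z => y; apply/eqP; rewrite -subr_eq0 -sqrf_eq0 eq_le sqr_ge0 andbT.
apply/ler_addgt0Pr => e e0; rewrite add0r.
(* The errors of u n as an approximate minimizer and as an approximation of z
   contribute e / 2 each; F y y + 1 avoids dividing by 0. *)
have K0 := F_ge0 y.
have K1 : 0 < F y y + 1 by lra.
have [|n1 _ Hn1] := epP (e / (4 * (F y y + 1))).
  by rewrite divr_gt0 ?mulr_gt0.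
have [n2 _ Hn2] : \forall n \near \oo,
    rdot (z - u n) (z - u n) < e / (4 * C * (F y y + 1)).
  by apply: (cvg_rdotP u z).1 => //; rewrite divr_gt0 ?mulr_gt0.
pose n := maxn n1 n2.
have h1 : ep n * (4 * (F y y + 1)) < e.
  by rewrite -ltr_pdivlMr ?mulr_gt0//; apply: Hn1; rewrite /= leq_maxl.
have h2 : rdot (z - u n) (z - u n) * (4 * C * (F y y + 1)) < e.
  by rewrite -ltr_pdivlMr ?mulr_gt0//; apply: Hn2; rewrite /= leq_maxr.
have h3 := symform_cauchy_schwarz nF (z - u n) y.
have h4 := FC (z - u n).
have h5 := lin_u n y.
have h6 : 0 < ep n := ep0 n.
have h7 : (F z y - l y) ^+ 2 <= 2 * F (z - u n) y ^+ 2 + 2 * (F (u n) y - l y) ^+ 2.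
  rewrite (symformBl sF); have := sqr_ge0 (F z y - F (u n) y - (F (u n) y - l y)).
  move: (F z y) (F (u n) y) (l y) => a b d; nra.
have h8 : F (z - u n) (z - u n) * F y y <= C * rdot (z - u n) (z - u n) * F y y.
  by rewrite ler_wpM2r.
have h9 : 0 <= C * rdot (z - u n) (z - u n) by rewrite mulr_ge0// ltW.
nra.
Qed.

End RealInner.

(** * Cholesky factorization of a nonnegative form *)

Lemma esum_nat_cvgP (R : realType) (f : nat -> R) (l : R) :
  (forall k, 0 <= f k) ->
  (\esum_(k in [set: nat]) (f k)%:E = l%:E)%E <->
  (\sum_(0 <= k < n) f k @[n --> \oo] --> l).
Proof.
move=> f0; rewrite -nneseries_esumT; last by move=> k; rewrite lee_fin.
have sumE : (fun n => (\sum_(0 <= k < n) (f k)%:E)%E) =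
            (fun n => (\sum_(0 <= k < n) f k)%:E).
  by apply/funext => n; rewrite sumEFin.
have cv : cvg ((\sum_(0 <= k < n) (f k)%:E)%E @[n --> \oo]).
  by apply: is_cvg_nneseries => k _ _; rewrite lee_fin.
split=> [fl|fl].
  have h : (\sum_(0 <= k < n) (f k)%:E)%E @[n --> \oo] --> l%:E by rewrite -fl.
  by move: h; rewrite sumE => /fine_cvg.
by apply: cvg_lim => //; rewrite sumE; apply: cvg_EFin => //; exact: nearW.
Qed.

(** The Schur complement of F at s stays nonnegative by the Cauchy-Schwarz
inequality.  When F s s = 0 the quotient is 0 by convention, which is the right
value since then F _ s = 0. *)
Lemma schur_symform (R : realType) (V : lmodType R[i]) (F : V -> V -> R) s :
  nonneg_symform F ->
  nonneg_symform (fun x y => F x y - F x s * F y s / F s s).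
Proof.
move=> nF; have [sF F0] := nF; split; last first.
  move=> x; have [s0|s0] := eqVneq (F s s) 0.
    by rewrite s0 invr0 mulr0 subr0.
  have sp : 0 < F s s by rewrite lt0r s0 F0.
  by rewrite subr_ge0 ler_pdivrMr// -expr2 symform_cauchy_schwarz.
split=> [x y|x y z|a x y].
- by rewrite (symformC sF) [F x s * _]mulrC.
- by rewrite !(symformDl sF) !mulrDl opprD addrACA.
- by rewrite !(symformZl sF) mulrBr !mulrA.
Qed.

Lemma schur_pivot_null (R : realType) (V : lmodType R[i]) (F : V -> V -> R) s y :
  nonneg_symform F -> F s y - F s s * F y s / F s s = 0.
Proof.
move=> nF; have [sF _] := nF; have [s0|s0] := eqVneq (F s s) 0.
  by rewrite s0 mul0r mul0r subr0 (symformC sF) (symform_null nF).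
by rewrite mulrAC divff// mul1r (symformC sF) subrr.
Qed.

Section Factor.
Context {R : realType} {H : completeNormedModType R[i]}.
Context (dot : {dot H for Num.conj}).
Hypothesis dot_norm : forall x : H, dot x x = `|x| ^+ 2.
Local Notation rdot := (rdot dot).
Variables (D : H -> H) (C : R) (s : nat -> H).
Hypothesis nD : nonneg_symform (fun x y => rdot x (D y)).
Hypothesis C0 : 0 < C.
Hypothesis DC : forall x, rdot x (D x) <= C * rdot x x.
Hypothesis s_dense :
  forall x (e : R), 0 < e -> exists n, rdot (x - s n) (x - s n) < e.

Let sR := rdot_symform dot.

(** The operator representing what is left of the form <x, D y> after n Schur
complements, at s 0, ..., s n.-1. *)
Fixpoint residual n : H -> H :=
  if n is k.+1 then
    fun y => residual k y - (rdot y (residual k (s k)) /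
      rdot (s k) (residual k (s k)))%:C *: residual k (s k)
  else D.

Let d n x y := rdot x (residual n y).

Let dS n x y : d n.+1 x y = d n x y - d n x (s n) * d n y (s n) / d n (s n) (s n).
Proof.
by rewrite /d /= (symformBr sR) (symformZr sR) mulrC mulrA.
Qed.

Lemma residual_nonneg n : nonneg_symform (d n).
Proof.
elim: n => [//|n IH]; have [[sC sD sZ] s0] := schur_symform _ _ _ (s n) IH.
by split=> [|x]; [split=> *|]; rewrite !dS.
Qed.

Lemma residual_null n m y : (m < n)%N -> d n (s m) y = 0.
Proof.
elim: n y => // n IH y; rewrite ltnS leq_eqVlt => /orP[/eqP->|mn].
  by rewrite dS schur_pivot_null//; exact: residual_nonneg.
by rewrite dS !IH// !mul0r subrr.
Qed.

(** The normalization makes (Re <x, pivot_vector n>)^2 the square removed by the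
n-th Schur complement; a null pivot gives the vector 0, as 0^-1 = 0. *)
Definition pivot_vector n : H :=
  ((Num.sqrt (rdot (s n) (residual n (s n))))^-1)%:C *: residual n (s n).

Lemma sqr_rdot_pivot n x : rdot x (pivot_vector n) ^+ 2 = d n x x - d n.+1 x x.
Proof.
have [_ d0] := residual_nonneg n.
rewrite dS opprB addrC subrK /pivot_vector (symformZr sR) exprMn exprVn.
rewrite sqr_sqrtr; last exact: d0.
by rewrite mulrC -expr2.
Qed.

Lemma sum_sqr_rdot_pivots n x :
  \sum_(0 <= k < n) rdot x (pivot_vector k) ^+ 2 = rdot x (D x) - d n x x.
Proof.
elim: n => [|n IH]; first by rewrite big_nil subrr.
by rewrite big_nat_recr//= IH sqr_rdot_pivot addrA subrK.
Qed.

(** The residual form vanishes against s m as soon as m < n, so its value at x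
is its value at x - s m, which is at most C |x - s m|^2. *)
Lemma residual_cvg0 x : d n x x @[n --> \oo] --> (0 : R).
Proof.
apply/cvgrPdist_lt => e e0.
have [|m sm] := s_dense x (e / C); first by rewrite divr_gt0.
exists m.+1 => // n /= mn; have [sd d0] := residual_nonneg n.
rewrite sub0r normrN ger0_norm//.
have -> : d n x x = d n (x - s m) (x - s m).
  by rewrite (symformBl sd) !(symformBr sd) (symformC sd x (s m)) !residual_null//; lra.
have : 0 <= rdot (x - s m) (D (x - s m)) - d n (x - s m) (x - s m).
  by rewrite -sum_sqr_rdot_pivots; apply: sumr_ge0 => k _; exact: sqr_ge0.
have := DC (x - s m); move: sm; rewrite ltr_pdivlMr//; lra.
Qed.

Lemma esum_sqr_rdot_pivots x :
  (\esum_(k in [set: nat]) (rdot x (pivot_vector k) ^+ 2)%:E = (rdot x (D x))%:E)%E.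
Proof.
apply/esum_nat_cvgP => [k|]; first exact: sqr_ge0.
under eq_fun do rewrite sum_sqr_rdot_pivots.
have := cvgB (cvg_cst (rdot x (D x))) (residual_cvg0 x).
by rewrite subr0; apply.
Qed.

End Factor.

(** * The frame form of a frame of iterations *)

Lemma esum_pair (R : realType) (I J : choiceType) (f : I -> J -> \bar R) :
  (forall i j, 0 <= f i j)%E ->
  (\esum_(k in [set: I * J]) f k.1 k.2 =
   \esum_(j in [set: J]) \esum_(i in [set: I]) f i j)%E.
Proof.
move=> f0; rewrite (esum_esum (J := fun _ : J => [set: I])) //.
rewrite (@reindex_esum _ _ _ (setT `*`` fun=> setT) _ (fun k : J * I => (k.2, k.1))) //.
split=> // [[j i] [j' i'] _ _ [-> ->] //|[i j] _ /=].
by exists (j, i).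
Qed.

Lemma esum_ge_term (R : realType) (K : choiceType) (f : K -> \bar R) k :
  (forall k, 0 <= f k)%E -> (f k <= \esum_(k in [set: K]) f k)%E.
Proof.
move=> f0; apply: esum_ge; exists [set k]; last by rewrite fsbig_set1.
by split => //; exact: finite_set1.
Qed.

Section Frames.
Context {R : realType} {H : completeNormedModType R[i]}.
Context (dot : {dot H for Num.conj}).
Hypothesis dot_norm : forall x : H, dot x x = `|x| ^+ 2.
Local Notation rdot := (rdot dot).
Let sR := rdot_symform dot.

Lemma rdoti x : rdot ('i%C *: x) ('i%C *: x) = rdot x x.
Proof.
by rewrite !rdotxx// normrZ complexiE normCi mul1r.
Qed.

Lemma sqr_dot_symform f : nonneg_symform
  (fun x y : H => rdot x f * rdot y f + rdot ('i%C *: x) f * rdot ('i%C *: y) f).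
Proof.
split=> [|x]; last by rewrite -!expr2 addr_ge0// sqr_ge0.
split=> [x y|x y z|a x y].
- by rewrite mulrC [X in _ + X]mulrC.
- by rewrite scalerDr !(symformDl sR); ring.
- by rewrite scalerA [_ * a%:C]mulrC -scalerA !(symformZl sR); ring.
Qed.

Lemma adjoint_exists (T : {linear H -> H}) : bounded_operator T ->
  exists S : H -> H, forall x y, dot (T x) y = dot x (S y).
Proof.
move=> /(bounded_rdot _ dot_norm)[M M0 TM].
have nR := rdot_nonneg _ dot_norm.
suff /choice[S TS] : forall y, exists z, forall x, dot (T x) y = dot x z.
  by exists S.
move=> y; have [|||||||z zP] := @symform_riesz _ _ _ dot_norm rdot 1 1
    (M * rdot y y) (fun x => rdot (T x) y) sR ltr01.
- by move=> x; rewrite mul1r.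
- by [].
- by move=> x; rewrite mul1r.
- by move=> x x'; rewrite linearD (symformDl sR).
- by move=> a x; rewrite linearZ (symformZl sR).
- by rewrite mulr_ge0//; case: nR.
- move=> x; apply: le_trans (symform_cauchy_schwarz nR _ _) _.
  by rewrite mulrAC ler_wpM2r//; case: nR.
exists z => x; rewrite [LHS]dotiE [RHS]dotiE -linearZ -!zP.
by rewrite !(symformC sR z).
Qed.

Lemma dot_iter (S T : H -> H) n x v :
  (forall x y, dot (S x) y = dot x (T y)) ->
  dot x (iter n T v) = dot (iter n S x) v.
Proof. by move=> ST; elim: n x => // n IH x; rewrite iterS -ST IH iterSr. Qed.

(** G is the quadratic form of the frame operator of the family (T^n v_i), and
p the part of the frame sum with n = 0: the terms of index n at x are those of
index 0 at S^n x. *)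
Lemma iteration_frame_form (S T : H -> H) :
  (forall x y, dot (S x) y = dot x (T y)) ->
  has_frame_of_iterations dot T ->
  exists (G : H -> H -> R) (p : H -> R) (A B : R),
  [/\ nonneg_symform G, (forall x, 0 <= p x), 0 < A /\ 0 < B,
      (forall x, A * rdot x x <= G x x <= B * rdot x x) &
      (forall x, \sum_(0 <= k < n) p (iter k S x) @[n --> \oo] --> G x x) /\
      (forall x, G x x = p x + G (S x) (S x))].
Proof.
move=> ST [I [v [A [B [A0 B0 fr]]]]].
pose F k x y := rdot x k * rdot y k + rdot ('i%C *: x) k * rdot ('i%C *: y) k.
have F0 k x : 0 <= F k x x by case: (sqr_dot_symform k) => _; exact.
have FE k x : complex.Re (`|dot x k| ^+ 2) = F k x x.
  by rewrite Re_sqr_dot /F -!expr2.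
pose f (k : I * nat) := iter k.2 T (v k.1).
have frF x : ((A * rdot x x)%:E <= \esum_(k in [set: I * nat]) (F (f k) x x)%:E <=
    (B * rdot x x)%:E)%E.
  by rewrite rdotxx//; under eq_esum => k _ do rewrite -FE; exact: fr.
have fin x : (\esum_(k in [set: I * nat]) (F (f k) x x)%:E < +oo)%E.
  have /andP[_] := frF x.
  by move=> /le_lt_trans; apply; rewrite ltry.
have [G [nG GE]] := sum_symform (fun k => sqr_dot_symform (f k)) fin.
pose q x := (\esum_(i in [set: I]) (F (v i) x x)%:E)%E.
have q_ge0 x : (0 <= q x)%E by apply: esum_ge0 => i _; rewrite lee_fin.
have Gq x : (G x x)%:E = (\esum_(n in [set: nat]) q (iter n S x))%E.
  rewrite GE (esum_pair _ _ _ (fun i n => (F (f (i, n)) x x)%:E)); last first.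
    by move=> i n; rewrite lee_fin.
  apply: eq_esum => n _; apply: eq_esum => i _.
  by rewrite -!FE (dot_iter _ _ _ _ _ ST).
have qfin x : (fine (q x))%:E = q x.
  rewrite fineK// ge0_fin_numE//; apply: (@le_lt_trans _ _ (G x x)%:E); last exact: ltry.
  rewrite Gq; exact: (esum_ge_term _ _ _ 0%N).
have Gcvg x : \sum_(0 <= k < n) fine (q (iter k S x)) @[n --> \oo] --> G x x.
  apply/esum_nat_cvgP => [k|]; first exact: fine_ge0.
  by rewrite Gq; apply: eq_esum => n _; rewrite qfin.
exists G, (fine \o q), A, B; split => //.
- by move=> x; exact: fine_ge0.
- by move=> x; have := frF x; rewrite -GE !lee_fin.
split=> // x.
pose u n := \sum_(0 <= k < n) fine (q (iter k S x)).
have uG : u n.+1 @[n --> \oo] --> G x x by rewrite (cvg_shiftS u); exact: Gcvg.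
apply: (cvg_unique _ uG) => //.
have -> : (fun n => u n.+1) = (fun n => fine (q x) +
    \sum_(0 <= k < n) fine (q (iter k S (S x)))).
  apply/funext => n; rewrite /u big_nat_recl//=; congr (_ + _).
  by apply: eq_bigr => k _; rewrite -iterS iterSr.
by apply: cvgD; [exact: cvg_cst|exact: Gcvg].
Qed.

(** A |S^n x|^2 is at most G(S^n x, S^n x), the tail from n on of the convergent
series of the p(S^k x). *)
Lemma adjoint_frame_stable (S T : H -> H) :
  (forall x y, dot (S x) y = dot x (T y)) ->
  has_frame_of_iterations dot T -> strongly_stable S.
Proof.
move=> ST /(iteration_frame_form _ _ ST)[G [p [A [B [nG p0 [A0 B0] AB [Gcvg GS]]]]]] x.
have GE n : G (iter n S x) (iter n S x) =
    G x x - \sum_(0 <= k < n) p (iter k S x).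
  elim: n => [|n IH]; first by rewrite big_nil subr0.
  rewrite big_nat_recr//= opprD addrA -IH.
  by rewrite [in RHS]GS [p _ + _]addrC addrK.
apply/(cvg_rdotP _ dot_norm) => e e0.
have /cvgrPdist_lt/(_ _ (mulr_gt0 A0 e0)) := Gcvg x.
apply: filterS => n; rewrite -GE ger0_norm; last by case: nG.
rewrite sub0r (symformNl sR) (symformNr sR) opprK => h.
rewrite -(ltr_pM2l A0); apply: le_lt_trans h; by case/andP: (AB (iter n S x)).
Qed.

End Frames.

(** * From strong stability to a frame of iterations of the adjoint *)

Section Converse.
Context {R : realType} {H : completeNormedModType R[i]}.
Context (dot : {dot H for Num.conj}).
Hypothesis dot_norm : forall x : H, dot x x = `|x| ^+ 2.
Local Notation rdot := (rdot dot).
Let sR := rdot_symform dot.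

Lemma rdot_adjoint (S T : H -> H) : (forall x y, dot (T x) y = dot x (S y)) ->
  forall x y, rdot (T x) y = rdot x (S y).
Proof. by move=> TS x y; rewrite /rdot TS. Qed.

(** P is the inverse of the operator of G.  The bounds are the inverses of those
of G, and T contracts the inverse form because S contracts G: all of it
follows from the Cauchy-Schwarz inequality, since G (P x) y = Re <x, y> makes
the norm of the inverse form dual to that of G. *)
Lemma inverse_form (G : H -> H -> R) (A B : R) (T S : H -> H) :
  (forall x y, dot (T x) y = dot x (S y)) ->
  nonneg_symform G -> 0 < A -> 0 < B ->
  (forall x, A * rdot x x <= G x x <= B * rdot x x) ->
  (forall x, G (S x) (S x) <= G x x) ->
  exists P : H -> H,
  [/\ nonneg_symform (fun x y => rdot x (P y)),
     (forall x, B^-1 * rdot x x <= rdot x (P x) <= A^-1 * rdot x x) &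
     (forall x, rdot (T x) (P (T x)) <= rdot x (P x))].
Proof.
move=> TS nG A0 B0 AB GS; have [sG G_ge0] := nG.
have nR := rdot_nonneg _ dot_norm; have rdot_ge0 x : 0 <= rdot x x by case: nR => _; exact.
suff /choice[P PG] : forall y, exists z, forall x, G z x = rdot y x.
  have hE x y : rdot x (P y) = G (P x) (P y) by rewrite PG.
  have GP x y : G x (P y) = rdot x y by rewrite (symformC sG) PG (symformC sR).
  exists P; split.
  - split=> [|x]; last by rewrite hE.
    split=> [x y|x y z|a x y]; last 2 first.
    + exact: symformDl.
    + exact: symformZl.
    + by rewrite !hE (symformC sG).
  - move=> x; rewrite hE.
    have /andP[a1 _] := AB (P x); have /andP[_ b1] := AB x.
    have c1 := symform_cauchy_schwarz nG (P x) x; rewrite PG in c1.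
    have c2 := symform_cauchy_schwarz nR x (P x); rewrite hE in c2.
    have := rdot_ge0 x; have := rdot_ge0 (P x); have := G_ge0 (P x).
    move: (G (P x) (P x)) (rdot x x) (G x x) (rdot (P x) (P x)) a1 b1 c1 c2.
    move=> h r g p a1 b1 c1 c2 h0 p0 r0.
    rewrite mulrC ler_pdivrMr// [A^-1 * _]mulrC ler_pdivlMr//; apply/andP; split.
      (* |x|^4 = G(P x, x)^2 <= h(x) G(x, x) <= h(x) B |x|^2 *)
      have [->|r1] := eqVneq r 0; first by rewrite mulr_ge0// ltW.
      have rp : 0 < r by rewrite lt0r r1 r0.
      by rewrite -(ler_pM2l rp) -expr2; apply: le_trans c1 _; rewrite mulrCA ler_wpM2l// mulrC.
    (* h(x)^2 = (Re <x, P x>)^2 <= |x|^2 |P x|^2 <= |x|^2 h(x) / A *)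
    have [->|h1] := eqVneq h 0; first by rewrite mul0r.
    have hp : 0 < h by rewrite lt0r h1 h0.
    rewrite -(ler_pM2l hp) mulrA -expr2.
    apply: (@le_trans _ _ (r * p * A)); first by rewrite ler_wpM2r// ltW.
    by rewrite -mulrA [h * r]mulrC ler_wpM2l// mulrC.
  - (* h(T x) = G(S z, P x) <= G(S z, S z)^(1/2) G(P x, P x)^(1/2)
       <= h(T x)^(1/2) h(x)^(1/2) *)
    move=> x; set z := P (T x).
    have E : rdot (T x) z = G (S z) (P x).
      by rewrite (rdot_adjoint _ _ TS) (symformC sR) GP.
    have := symform_cauchy_schwarz nG (S z) (P x).
    rewrite -E [in leLHS]hE -/z -(hE x).
    have hz := GS z; have := G_ge0 z; have := G_ge0 (P x).
    rewrite -(hE x) [rdot (T x) z]hE -/z.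
    move: (G z z) (rdot x (P x)) (G (S z) (S z)) hz => a b g ga b0 a0 h.
    have [->//|a1] := eqVneq a 0.
    have ap : 0 < a by rewrite lt0r a1 a0.
    by rewrite -(ler_pM2l ap) -expr2; apply: le_trans h _; rewrite ler_wpM2r.
(* P y represents the functional <y, _> for the form G. *)
move=> y; apply: (@symform_riesz _ _ _ dot_norm G A B (rdot y y)) => //.
- by move=> x; case/andP: (AB x).
- by move=> x; case/andP: (AB x).
- by move=> x x'; rewrite (symformDr sR).
- by move=> a x; rewrite (symformZr sR).
- by move=> x; exact: symform_cauchy_schwarz.
Qed.

(** The frame consists of the S^n w_j, where the squares of Re <x, w_j> sum to
the defect Re <x, P x> - Re <T x, P (T x)>.  Summed over the orbit of x the
defects telescope to Re <x, P x>, and adding the same at i x gives the complex frame sum: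
hence the bounds 2 a and 2 b. *)
Lemma defect_frame (T : {linear H -> H}) (S P : H -> H) (a b : R) :
  separable H -> (forall x y, dot (T x) y = dot x (S y)) -> strongly_stable T ->
  nonneg_symform (fun x y => rdot x (P y)) ->
  0 < a -> 0 < b ->
  (forall x, a * rdot x x <= rdot x (P x) <= b * rdot x x) ->
  (forall x, rdot (T x) (P (T x)) <= rdot x (P x)) ->
  has_frame_of_iterations dot S.
Proof.
move=> Hsep TS Tst nh a0 b0 ab hT.
have [s s_dense] := rdot_dense _ dot_norm Hsep.
have rT := rdot_adjoint _ _ TS; have [sh h_ge0] := nh.
pose D y := P y - S (P (T y)).
have DE x y : rdot x (D y) = rdot x (P y) - rdot (T x) (P (T y)).
  by rewrite /D (symformBr sR) rT.
have nD : nonneg_symform (fun x y => rdot x (D y)).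
  split=> [|x]; last by rewrite DE subr_ge0.
  split=> [x y|x y z|c x y]; last 2 first.
  - exact: symformDl.
  - exact: symformZl.
  by rewrite !DE (symformC sh x) (symformC sh (T x)).
have Db x : rdot x (D x) <= b * rdot x x.
  rewrite DE; have := h_ge0 (T x); have /andP[_] := ab x; lra.
have wP := esum_sqr_rdot_pivots dot D b s nD b0 Db s_dense.
set w := pivot_vector dot D s in wP.
pose h x := rdot x (P x).
(* The sum telescopes; the remainder h (T^n x) tends to 0 by stability. *)
have hD x : (\esum_(n in [set: nat]) (rdot (iter n T x) (D (iter n T x)))%:E = (h x)%:E)%E.
  apply/esum_nat_cvgP => [k|]; first by case: nD => _; apply.
  have sumE n : \sum_(0 <= k < n) rdot (iter k T x) (D (iter k T x)) =
      h x - h (iter n T x).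
    elim: n => [|n IH]; first by rewrite big_nil subrr.
    by rewrite big_nat_recr//= IH DE addrA subrK.
  under eq_fun do rewrite sumE.
  suff h0 : h (iter n T x) @[n --> \oo] --> (0 : R).
    by have := cvgB (cvg_cst (h x)) h0; rewrite subr0; apply.
  apply/cvgrPdist_lt => e e0.
  have := (cvg_rdotP _ dot_norm _ _).1 (Tst x) _ (divr_gt0 e0 b0).
  apply: filterS => n; rewrite !sub0r (symformNl sR) (symformNr sR) opprK.
  rewrite ltr_pdivlMr// normrN ger0_norm; last exact: h_ge0.
  by have /andP[_] := ab (iter n T x); rewrite /h; lra.
exists nat, w, (2 * a), (2 * b); split; try by rewrite mulr_gt0.
move=> x /=; rewrite -(rdotxx _ dot_norm).
rewrite (esum_pair _ _ _ (fun j n => (complex.Re (`|dot x (iter n S (w j))| ^+ 2))%:E)); last first.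
  by move=> j n; rewrite lee_fin Re_sqr_dot addr_ge0// sqr_ge0.
pose y := 'i%C *: x.
rewrite (eq_esum (b := fun n => ((rdot (iter n T x) (D (iter n T x)))%:E +
   (rdot (iter n T y) (D (iter n T y)))%:E)%E)); last first.
  move=> n _; rewrite -!wP -esumD; last 2 first.
  - by move=> j _; rewrite lee_fin sqr_ge0.
  - by move=> j _; rewrite lee_fin sqr_ge0.
  apply: eq_esum => j _; rewrite (dot_iter _ _ _ _ _ _ TS) Re_sqr_dot EFinD.
  suff -> : iter n T y = 'i%C *: iter n T x by [].
  by elim: n => // n IH; rewrite !iterS IH linearZ.
rewrite esumD; last 2 first.
- by move=> n _; rewrite lee_fin; case: nD => _; apply.
- by move=> n _; rewrite lee_fin; case: nD => _; apply.
rewrite !hD -EFinD !lee_fin /h.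
have := ab x; have := ab y; rewrite (rdoti _ dot_norm) => /andP[h1 h2] /andP[h3 h4].
by apply/andP; split; lra.
Qed.

End Converse.

Theorem theorem1p4 (R : realType) (H : completeNormedModType R[i])
    (dot : {dot H for Num.conj})
    (dot_norm : forall x : H, dot x x = `|x| ^+ 2)
    (H_separable : separable H)
    (H_infinite_dimensional : ~ finite_dimensional H)
    (T : {linear H -> H}) (T_bounded : bounded_operator T)
    (T_frame : has_frame_of_iterations dot T) :
  has_frame_of_iterations dot (adjoint dot T) <-> strongly_stable T.
Proof.
have [S TS] := adjoint_exists _ dot_norm _ T_bounded.
have ST x y : dot (S x) y = dot x (T y) by rewrite dotC -TS -dotC.
rewrite (adjoint_eq TS); split=> [|T_stable].
  exact: (adjoint_frame_stable _ dot_norm _ _ TS).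
have [G [p [A [B [nG p0 [A0 B0] AB [_ GS]]]]]] :=
  iteration_frame_form _ dot_norm _ _ ST T_frame.
have [|P [nP PAB PT]] := inverse_form _ dot_norm _ _ _ _ _ TS nG A0 B0 AB.
  by move=> x; rewrite (GS x) lerDr.
by apply: (defect_frame _ dot_norm _ _ _ _ _ _ TS T_stable nP _ _ PAB PT);
  rewrite ?invr_gt0.
Qed.
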